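(* Let $G = (N,A)$ be an influence diagram with $N = N^C \cup N^D \cup N^V$ and $|N^V| > 1$. Let $\overline{G} = (\overline{N},\overline{A})$ be the influence diagram obtained from $G$ by the single-value-node conversion (described in the context). Then $\overline{G}$ is equivalent to $G$.
   Context: **Influence diagrams.** An influence diagram (ID) is a finite directed acyclic graph $G=(N,A)$ whose node set is partitioned as $N = N^C \cup N^D \cup N^V$ into chance nodes $N^C$, decision nodes $N^D$ and value nodes $N^V$. For $j\in N$, $I(j) = \{i \in N : (i,j)\in A\}$ denotes the set of parents of $j$ (its information set). Value nodes are not parents of any node. The diagram carries the following data. - Each node $j$ has a finite state space $S_j$. For $C\subseteq N$, $S_C := \prod_{c\in C} S_c$, and elements are written $s_C = (s_c)_{c\in C}$. - Each $j\in N^C\cup N^V$ has a conditional probability distribution $\mathbb{P}_G(s_j \mid s_{I(j)})$ on $S_j$, for each $s_{I(j)}\in S_{I(j)}$. - Each $v \in N^V$ has a real-valued utility $u(s_v)$, $s_v \in S_v$. A decision strategy assigns to each $d \in N^D$ a function $\delta(s_d\mid s_{I(d)})$ of $(s_{I(d)}, s_d) \in S_{I(d)}\times S_d$ with values in $\{0,1\}$. It is feasible if for every $s_{I(d)}$ exactly one $s_d$ has $\delta(s_d\mid s_{I(d)})=1$. Given a strategy $\delta$, for a decision node $d$ one puts $\mathbb{P}(s_d\mid s_{I(d)}) := \delta(s_d\mid s_{I(d)})$, so that products $\prod_{n\in N}\mathbb{P}(s_n\mid s_{I(n)})$ over all nodes make sense. **Equivalence of IDs.** Two IDs $G_1=(N_1,A_1)$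 and $G_2=(N_2,A_2)$ are equivalent if both of the following hold. (a) $G_1$ and $G_2$ share the same chance and decision nodes, and the same arcs into these nodes. (b) There is a bijection $g: S_{N_1}\to S_{N_2}$ such that for any decision strategy $\delta(s_d\mid s_{I(d)})$, $d\in N_1^D$ (used in both diagrams), and every $s\in S_{N_1}$, writing $\bar s = g(s)$, $$\prod_{n\in N_1}\mathbb{P}_{G_1}(s_n\mid s_{I(n)}) = \prod_{n\in N_2}\mathbb{P}_{G_2}(\bar s_n\mid \bar s_{I(n)}) \quad\text{and}\quad \sum_{v\in N_1^V}u(s_v)=\sum_{v\in N_2^V}u(\bar s_v).$$ **Single-value-node conversion.** Given $G=(N,A)$, the ID $\overline{G}=(\overline{N},\overline{A})$ is constructed as follows. 1. The chance and decision nodes of $\overline{G}$ are those of $G$, with the same state spaces, and $\mathbb{P}_{\overline{G}}(s_j\mid s_{I(j)})=\mathbb{P}_G(s_j\mid s_{I(j)})$ for all $j\in N^C$. 2. All arcs $(a,b)\in A$ with $b\in N^C\cup N^D$ are put in $\overline{A}$. 3. A single value node $\overline{v}$ is added, with state space $S_{\overline{v}}=\prod_{v\in N^V}S_v$. So a state $s_{\overline v}$ is a tuple $(s_v)_{v\in N^V}$. 4. For every $v\in N^V$ and every $a\in I(v)$ (parents in $G$), the arc $(a,\overline{v})$ is added to $\overline{A}$. Hence the parent set of $\overline v$ is $I(\overline{v})=\bigcup_{v\in N^V}I(v)$. 5. For $s_{\overline{v}}=(s_v)_{v\in N^V}$, set $u(s_{\overline{v}})=\sum_{v\in N^V}u(s_v)$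 and $\mathbb{P}_{\overline{G}}(s_{\overline{v}}\mid s_{I(\overline{v})})=\prod_{v\in N^V}\mathbb{P}_G(s_v\mid s_{I(v)})$, where $s_{I(v)}$ is the restriction of $s_{I(\overline v)}$ to $I(v)$. *)

(* Defs.v *)
From HB Require Import structures.
From mathcomp Require Import all_boot all_order all_algebra.
From mathcomp Require Import reals.

Set Implicit Arguments.
Unset Strict Implicit.
Unset Printing Implicit Defensive.

Import Order.TTheory GRing.Theory Num.Theory.
Local Open Scope ring_scope.

(* The chance and decision nodes of a diagram, their state spaces, and the
   arcs into them.  Since value nodes are parents of no node, every
   information set I(j) is a set of chance and decision nodes. *)
Record skeleton := Skeleton {
  chance : finType;
  decision : finType;
  state : chance + decision -> finType;
  parents : chance + decision -> {set chance + decision}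
}.

Definition inner (K : skeleton) : finType := (chance K + decision K)%type.

(* S_C, for a set C of chance and decision nodes *)
Definition config (K : skeleton) (C : {set inner K}) : Type :=
  {dffun forall i : {i : inner K | i \in C}, state (val i)}.

Definition restrict (K : skeleton) (B C : {set inner K}) (BC : B \subset C)
    (x : config C) : config B :=
  [ffun i : {i : inner K | i \in B} =>
     x (exist _ (val i) (subsetP BC (val i) (valP i)))].

(* A decision strategy, not necessarily feasible: delta (s_d | s_I(d)) *)
Definition strategy (K : skeleton) : Type :=
  forall d : decision K, config (parents (inr d)) -> state (inr d) -> bool.

Record graph := Graph {
  core :> skeleton;
  value : finType;
  vstate : value -> finType;
  vparents : value -> {set inner core}
}.

Definition node (G : graph) : finType := (inner G + value G)%type.

Definition nstate (G : graph) (n : node G) : finType :=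
  match n with inl j => state j | inr v => vstate v end.

(* The information set I(n) *)
Definition info (G : graph) (n : node G) : {set inner G} :=
  match n with inl j => parents j | inr v => vparents v end.

Definition arc (G : graph) : rel (node G) :=
  fun m n => match m with inl i => i \in info n | inr _ => false end.

(* No arc (x, y) closes a directed cycle; loops are excluded by y = x. *)
Definition acyclic (T : finType) (e : rel T) : Prop :=
  forall x y, e x y -> ~~ connect e y x.

Definition is_distribution (R : realType) (T : finType) (p : T -> R) : Prop :=
  (forall a, 0 <= p a) /\ \sum_a p a = 1.

Record diagram (R : realType) := Diagram {
  dgraph :> graph;
  cprob : forall c : chance dgraph,
    config (parents (inl c)) -> state (inl c) -> R;
  vprob : forall v : value dgraph, config (vparents v) -> vstate v -> R;
  util : forall v : value dgraph, vstate v -> R;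
  dgraph_acyclic : acyclic (@arc dgraph);
  cprob_distribution : forall c x, is_distribution (@cprob c x);
  vprob_distribution : forall v x, is_distribution (@vprob v x)
}.

(* S_N *)
Definition full_config (G : graph) : Type :=
  {dffun forall n : node G, nstate n}.

Definition proj (G : graph) (C : {set inner G}) (s : full_config G) :
    config C :=
  [ffun i : {i : inner G | i \in C} => s (inl (val i)) : state (val i)].

(* P(s_n | s_I(n)), with the strategy used at the decision nodes *)
Definition prob (R : realType) (G : diagram R) (delta : strategy G)
    (n : node G) : config (info n) -> nstate n -> R :=
  match n return config (info n) -> nstate n -> R with
  | inl (inl c) => @cprob R G c
  | inl (inr d) => fun x a => (delta d x a)%:R
  | inr v => @vprob R G v
  end.

Definition joint (R : realType) (G : diagram R) (delta : strategy G)
    (s : full_config G) : R :=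
  \prod_(n : node G) prob delta (proj (info n) s) (s n).

Definition total_util (R : realType) (G : diagram R) (s : full_config G) : R :=
  \sum_(v : value G) util (s (inr v) : vstate v).

(* The equality e of skeletons says that the two diagrams share their chance
   and decision nodes and the arcs into them; it also lets a strategy of G1
   be used in G2. *)
Definition equivalent (R : realType) (G1 G2 : diagram R) : Prop :=
  exists e : core G1 = core G2,
  exists g : full_config G1 -> full_config G2,
    bijective g /\
    forall (delta : strategy G1) (s : full_config G1),
      joint delta s = joint (ecast K (strategy K) e delta) (g s) /\
      total_util s = total_util (g s).

Section SingleValue.
Variables (R : realType) (G : diagram R).

Definition svn_graph : graph :=
  @Graph G unit (fun=> {dffun forall v : value G, vstate v} : finType)
    (fun=> \bigcup_(v : value G) vparents v).

Lemma vparents_sub (v : value G) :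
  vparents v \subset \bigcup_(w : value G) vparents w.
Proof. exact: bigcup_sup. Qed.

Definition svn_prob (u : value svn_graph) (x : config (vparents u))
    (a : vstate u) : R :=
  \prod_(v : value G) vprob (restrict (vparents_sub v) x) (a v).

Definition svn_util (u : value svn_graph) (a : vstate u) : R :=
  \sum_(v : value G) util (a v).

Lemma connect_inner (H : graph) (x y : inner H) :
  connect (@arc H) (inl x) (inl y) =
  connect (fun i j : inner H => i \in parents j) x y.
Proof.
apply/idP/idP => /connectP[p].
- have no_out (v : value H) q : path (@arc H) (inr v) q -> q = [::].
    by case: q.
  elim: p x => [|[z|v] p IHp] x /=.
  + by move=> _ [->]; exact: connect0.
  + case/andP=> xz /IHp{}IHp /IHp; apply: connect_trans.
    exact: connect1.
  + by case/andP=> _ /no_out ->.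
- elim: p x => [|z p IHp] x /=; first by move=> _ ->; exact: connect0.
  case/andP=> xz /IHp{}IHp /IHp; apply: connect_trans.
  exact: connect1.
Qed.

Lemma svn_acyclic : acyclic (@arc svn_graph).
Proof.
move=> [x|u] // [y|u] xy.
  by rewrite connect_inner -(@connect_inner G) (@dgraph_acyclic R G (inl x) (inl y)).
by apply/connectP => -[[|z p]].
Qed.

Lemma svn_prob_distribution (u : value svn_graph) (x : config (vparents u)) :
  is_distribution (@svn_prob u x).
Proof.
split=> [a|].
  by apply: prodr_ge0 => v _; have [] := vprob_distribution (restrict (vparents_sub v) x).
pose T_ (v : value G) : finType := vstate v.
pose p v := @vprob R G v (restrict (vparents_sub v) x).
pose F v : {ffun T_ v -> R} := [ffun a => p v a].
rewrite /svn_prob /= (reindex (@dffun_of_fprod _ T_)) /=; last first.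
  exact/onW_bij/dffun_of_fprod_bij.
transitivity (\sum_(t : fprod T_) \prod_(v : value G) F v (t v)).
  by apply: eq_bigr => t _; apply: eq_bigr => v _; rewrite !ffunE.
rewrite (big_fprod_dep _ _ F predT) big_mkcondr /=.
rewrite -(bigA_distr_big_dep _ (fun v => untag 0 (F v))).
apply: big1 => v _; rewrite -(big_tag (fun v : value G => F v)).
under eq_bigr do rewrite ffunE.
by have [] := vprob_distribution (restrict (vparents_sub v) x).
Qed.

Definition single_value : diagram R :=
  @Diagram R svn_graph (@cprob R G) svn_prob svn_util svn_acyclic
    (@cprob_distribution R G) svn_prob_distribution.

End SingleValue.

(* Main.v *)
Require Import Defs.
From mathcomp Require Import all_boot all_order all_algebra.
From mathcomp Require Import reals.

Set Implicit Arguments.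
Unset Strict Implicit.
Unset Printing Implicit Defensive.

(** A state of the merged value node is by construction a tuple of states of the original value
    nodes, so regrouping coordinates identifies the two full state spaces. Chance and decision
    factors do not change, and the merged node's probability and utility are defined as the product
    and the sum of the original ones. [joint_unbundle] and [total_util_unbundle] record this. *)

Section Unbundle.
Variables (R : realType) (G : diagram R).
Notation H := (single_value G).

Definition unbundle (t : full_config H) : full_config G :=
  [ffun n : node G => match n return nstate n with
    | inl j => t (inl j)
    | inr v => (t (inr tt) : {dffun forall w : value G, vstate w}) v
    end].

Definition bundle (s : full_config G) : full_config H :=
  [ffun n : node H => match n return nstate n with
    | inl j => s (inl j)
    | inr _ => [ffun v : value G => s (inr v) : vstate v]
    end].

Lemma unbundleK : cancel unbundle bundle.
Proof.
move=> t; apply/ffunP => -[j|[]]; rewrite !ffunE //.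
by apply/ffunP => v; rewrite !ffunE.
Qed.

Lemma bundleK : cancel bundle unbundle.
Proof. by move=> s; apply/ffunP => -[j|v]; rewrite !ffunE. Qed.

(** Regrouping moves only value coordinates, and no information set contains a value node. *)
Lemma proj_unbundle (C : {set inner G}) (t : full_config H) :
  proj C (unbundle t) = @proj H C t.
Proof. by apply/ffunP => i; rewrite !ffunE. Qed.

(** Needed because [svn_prob] reads the parents of each [v] through the union of all the
    [vparents]. *)
Lemma restrict_proj (K : graph) (B C : {set inner K}) (BC : B \subset C)
  (s : full_config K) : restrict BC (proj C s) = proj B s.
Proof. by apply/ffunP => i; rewrite !ffunE. Qed.

Lemma joint_unbundle (delta : strategy G) (t : full_config H) :
  @joint R H delta t = joint delta (unbundle t).
Proof.
rewrite /joint !big_sumType /=; congr (_ * _ * _)%R.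
- by apply: eq_bigr => c _; rewrite proj_unbundle !ffunE.
- by apply: eq_bigr => d _; rewrite proj_unbundle !ffunE.
(* The only value node is [tt]; its factor unfolds to a product over the original value nodes. *)
- rewrite (big_pred1 tt) => [|[]//]; apply: eq_bigr => v _.
  by rewrite (restrict_proj (K := H)) proj_unbundle !ffunE.
Qed.

Lemma total_util_unbundle (t : full_config H) :
  total_util t = total_util (unbundle t).
Proof.
rewrite /total_util (big_pred1 tt) => [|[]//].
by apply: eq_bigr => v _; rewrite !ffunE.
Qed.

End Unbundle.

Theorem proposition3p2 (R : realType) (G : diagram R)
  (hV : (1 < #|value G|)%N) : equivalent (single_value G) G.
Proof.
(* Both diagrams have the same [core] by conversion, so the cast of [delta] computes away. *)
exists (erefl (core G)), (@unbundle R G); split.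
  by exists (@bundle R G); [exact: unbundleK | exact: bundleK].
by move=> delta t; split; [exact: joint_unbundle | exact: total_util_unbundle].
Qed.
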